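(* Let $\alpha\in[0,1]$, $\rho>0$, and let $a_0(n),a_1(n)$ be real sequences such that $a_0(n)$ is bounded and $2a_0(n)+a_1(n)=1$ for every $n$. Then there is a positive constant $C_3$, independent of $n$ and $f$, such that for every bounded measurable function $f:[0,1]\to\mathbb{R}$ and every $n\ge 2$, $$\bigl\|J_{n,\alpha,\rho}^{M,1}f-f\bigr\|\le \bigl(1+3|a_0(n)|\bigr)\,C_3\,\omega\!\left(f;\frac{1}{\sqrt n}\right),$$ where $\|\cdot\|$ is the uniform norm over $[0,1]$ and $\omega(f;\delta)$ is the first order modulus of continuity.
   Context: Fix $\alpha\in[0,1]$ and $\rho>0$. For $x\in[0,1]$ let $p_{1,0,\alpha}(x)=1-x$, $p_{1,1,\alpha}(x)=x$, and for $m\ge 2$, $0\le k\le m$, $$p_{m,k,\alpha}(x)=\left[\binom{m-2}{k}(1-\alpha)x+\binom{m-2}{k-2}(1-\alpha)(1-x)+\binom{m}{k}\alpha x(1-x)\right]x^{k-1}(1-x)^{m-k-1}$$ (understood as a polynomial in $x$, with $\binom{r}{s}=0$ if $s<0$ or $s>r$); $p_{m,k,\alpha}=0$ if $k<0$ or $k>m$. Let $$\mu_{n,k}^\rho(t)=\frac{t^{k\rho}(1-t)^{(n-k)\rho}}{B(k\rho+1,(n-k)\rho+1)},\quad t\in[0,1],$$ where $B$ is the Beta function. Given real sequences $a_0(n),a_1(n)$, put $a(x,n)=a_1(n)x+a_0(n)$ and, for $n\ge2$, $$J_{n,\alpha,\rho}^{M,1}(f;x)=\sum_{k=0}^n\bigl[a(x,n)\,p_{n-1,k,\alpha}(x)+a(1-x,n)\,p_{n-1,k-1,\alpha}(x)\bigr]\int_0^1\mu_{n,k}^\rho(t)f(t)\,dt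 .$$ For a bounded function $f$ on $[0,1]$ and $\delta>0$, $$\omega(f;\delta)=\sup\{|f(x)-f(y)|:\ x,y\in[0,1],\ |x-y|\le\delta\}.$$ *)

(* Defs.v *)
From HB Require Import structures.
From mathcomp Require Import all_boot all_order all_algebra.
From mathcomp Require Import all_classical all_reals all_analysis.
From mathcomp Require Import zify.

Set Implicit Arguments.
Unset Strict Implicit.
Unset Printing Implicit Defensive.

Import Order.TTheory GRing.Theory Num.Theory.
Import numFieldNormedType.Exports.

Local Open Scope classical_set_scope.
Local Open Scope ring_scope.

(* The factor x^(k-1) (1-x)^(m-k-1) of the usual formula is distributed over
   the bracket, so that only nonnegative exponents remain wherever the
   binomial coefficient is nonzero: see [p_alphaE]. For k > m all terms
   vanish. The value for m = 0 is irrelevant. *)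
Definition p_alpha (R : realType) (alpha : R) (m k : nat) (x : R) : R :=
  if (m <= 1)%N then
    match k with
    | 0 => 1 - x
    | 1 => x
    | _ => 0
    end
  else
    'C(m - 2, k)%:R * (1 - alpha) * (x ^+ k * (1 - x) ^+ (m - k - 1))
    + (if (2 <= k)%N then 'C(m - 2, k - 2)%:R else 0) * (1 - alpha)
      * (x ^+ (k - 1) * (1 - x) ^+ (m - k))
    + 'C(m, k)%:R * alpha * (x ^+ k * (1 - x) ^+ (m - k)).

Lemma p_alphaE (R : realType) (alpha : R) (m k : nat) (x : R) :
  (2 <= m)%N -> (k <= m)%N -> 0 < x < 1 ->
  p_alpha alpha m k x =
  ('C(m - 2, k)%:R * (1 - alpha) * x
   + (if (2 <= k)%N then 'C(m - 2, k - 2)%:R else 0) * (1 - alpha) * (1 - x)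
   + 'C(m, k)%:R * alpha * x * (1 - x))
  * (x ^ (k%:Z - 1) * (1 - x) ^ (m%:Z - k%:Z - 1)).
Proof.
move=> m2 km /andP[x0 x1].
have xN0 : x != 0 by rewrite gt_eqF.
have yN0 : 1 - x != 0 by rewrite subr_eq0 gt_eqF.
have ex : x * x ^ (k%:Z - 1) = x ^+ k.
  by rewrite -[X in X * _]expr1z -expfzDr// addrC subrK.
have ey : (1 - x) * (1 - x) ^ (m%:Z - k%:Z - 1) = (1 - x) ^+ (m - k).
  by rewrite -[X in X * _]expr1z -expfzDr// [X in _ ^ X]addrC subrK subzn.
rewrite /p_alpha leqNgt m2/= !mulrDl; congr (_ + _ + _).
- have [km2|km2] := leqP k (m - 2); last by rewrite bin_small// !mul0r.
  have km1 : (k < m)%N by lia.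
  rewrite -!mulrA; congr (_ * (_ * _)); rewrite mulrA ex; congr (_ * _).
  by rewrite subzn// subzn// subn_gt0.
- case: ifP => k2; last by rewrite !mul0r.
  rewrite -!mulrA; congr (_ * (_ * _)); rewrite -ey mulrCA; congr (_ * _).
  by rewrite (subzn (ltnW k2)).
- by rewrite -ex -ey -!mulrA; congr (_ * (_ * (_ * _))); rewrite mulrCA.
Qed.

(* Lebesgue (not merely Borel) measurability: the source carries the
   sigma-algebra of [completed_lebesgue_measure]. *)
Definition lebesgue_measurable_fun (R : realType) (D : set R) (f : R -> R) :=
  measurable_fun (D : set (caratheodory_type (@wlength R idfun)^*%mu)) f.

Definition Beta (R : realType) (p q : R) : R :=
  \int[@completed_lebesgue_measure R]_(t in `[0, 1])
    (t `^ (p - 1) * (1 - t) `^ (q - 1)).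

Definition mu_rho (R : realType) (rho : R) (n k : nat) (t : R) : R :=
  t `^ (k%:R * rho) * (1 - t) `^ ((n - k)%:R * rho)
  / Beta (k%:R * rho + 1) ((n - k)%:R * rho + 1).

Definition a_lin (R : realType) (a0 a1 : nat -> R) (x : R) (n : nat) : R :=
  a1 n * x + a0 n.

Definition J (R : realType) (alpha rho : R) (a0 a1 : nat -> R) (n : nat)
    (f : R -> R) (x : R) : R :=
  \sum_(0 <= k < n.+1)
    (a_lin a0 a1 x n * p_alpha alpha n.-1 k x
     + a_lin a0 a1 (1 - x) n
       * (if k is k'.+1 then p_alpha alpha n.-1 k' x else 0))
    * \int[@completed_lebesgue_measure R]_(t in `[0, 1])
        (mu_rho rho n k t * f t).

Definition unif_norm01 (R : realType) (g : R -> R) : \bar R :=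
  ereal_sup [set (`|g x|)%:E | x in `[0, 1]].

Definition modulus01 (R : realType) (f : R -> R) (delta : R) : \bar R :=
  ereal_sup [set (`|f xy.1 - f xy.2|)%:E | xy in
    [set xy : R * R | [/\ 0 <= xy.1 <= 1, 0 <= xy.2 <= 1 &
                          `|xy.1 - xy.2| <= delta]]].

(* Main.v *)
Require Import Defs.
From mathcomp Require Import all_boot all_order all_algebra.
From mathcomp Require Import all_classical all_reals all_analysis.
From mathcomp Require Import measurable_realfun.
From mathcomp Require Import ring lra zify.

Set Implicit Arguments.
Unset Strict Implicit.
Unset Printing Implicit Defensive.

Import Order.TTheory GRing.Theory Num.Theory.
Import numFieldNormedType.Exports.

Local Open Scope classical_set_scope.
Local Open Scope ring_scope.

(** The operator is an affine combination of two averages. With m = n - 1 and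
    h k the integral of f against the k-th Beta density, splitting the sum gives
    J f x = a(x) * E h + a(1 - x) * E (h \o S), where
    E g = \sum_k p_(m,k)(x) g k is a mean with respect to a probability on
    {0, ..., m} ([J_alpha_mean]). The normalization 2 a0 + a1 = 1 says exactly
    that the two coefficients add up to 1, and it bounds each of them by
    1 + |a0| ([a_lin_norm_le]). It therefore suffices to bound
    |E h - f x| and |E (h \o S) - f x| by a constant times the modulus W of f
    at 1 / sqrt n.

    Cutting a segment into pieces of length 1 / sqrt n gives the usual
    pointwise estimate |f t - f x| <= (1 + n (t - x)^2) W ([dist_le_sqr]), so
    only second moments are left.

    - For the Beta density with exponents a = k rho and b = (n - k) rho, one
      integration by parts yields the recurrences of the Beta function
      ([beta_intSl], [beta_intSr]), hence the exact second moment about x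
      ([beta_second_moment]). Its variance is O(1/n) and its mean differs from
      k / n by O(1/n), so n times the second moment is at most
      1/(2 rho) + (2/n) (k - n x)^2 ([beta_spread_le]).
    - For m >= 2 the weights p_(m,k)(x) are the law of a mixture: with
      probability alpha a binomial variable with m trials, and with probability
      1 - alpha a binomial variable with m - 2 trials plus twice a Bernoulli
      variable ([alpha_meanE]). Its mean is m x and its variance is
      (m + 2 (1 - alpha)) x (1 - x) ([alpha_mean_sqr]), so the mean of
      (k - n x)^2, shifted or not, is at most n ([alpha_mean_sqr_le]).

    Together both averages are within (3 + 1/(2 rho)) W of f x, and the theorem
    holds with C3 = 2 (3 + 1/(2 rho)). *)

(** * Moments of the weights p_(m,k) *)

Section bernstein_moments.
Context {R : realType}.
Implicit Types (x c alpha : R) (g : nat -> R) (m : nat).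

Definition bernstein m x g : R :=
  \sum_(k < m.+1) 'C(m, k)%:R * (x ^+ k * (1 - x) ^+ (m - k)) * g k.

Lemma bernstein0 x g : bernstein 0 x g = g 0.
Proof. by rewrite /bernstein big_ord1 bin0 !expr0 !mul1r. Qed.

(** Condition on the outcome of one of the m + 1 Bernoulli trials; algebraically
    this is the Pascal rule. *)
Lemma bernsteinS m x g : bernstein m.+1 x g =
  (1 - x) * bernstein m x g + x * bernstein m x (fun k => g k.+1).
Proof.
rewrite /bernstein !mulr_sumr big_ord_recl/= bin0 subn0.
rewrite [X in _ = X + _]big_ord_recl/= bin0 subn0 -addrA; congr (_ + _).
  by rewrite exprS; ring.
under eq_bigr => k _ do rewrite /bump/= add1n subSS binS natrD mulrDl mulrDl.
rewrite big_split/=; congr (_ + _); last first.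
  by apply: eq_bigr => k _; rewrite exprS; ring.
rewrite big_ord_recr/= bin_small// !mul0r addr0.
apply: eq_bigr => k _; rewrite /bump/= add1n.
by rewrite -(subnSK (ltn_ord k)) !exprS; ring.
Qed.

(** Variance plus squared bias. Stated for every centre c because the induction
    step applies the hypothesis to c and to c - 1. *)
Lemma bernstein_sqr m x c : bernstein m x (fun k => (k%:R - c) ^+ 2) =
  m%:R * (x * (1 - x)) + (m%:R * x - c) ^+ 2.
Proof.
elim: m c => [|m IHm] c; first by rewrite bernstein0; ring.
rewrite bernsteinS IHm.
have -> : (fun k : nat => (k.+1%:R - c) ^+ 2) = (fun k => (k%:R - (c - 1)) ^+ 2).
  by apply/funext => k; rewrite -natr1; congr (_ ^+ 2); ring.
by rewrite IHm -natr1; ring.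
Qed.

Lemma bernstein_cst m x c : bernstein m x (fun=> c) = c.
Proof.
elim: m => [|m IHm]; first by rewrite bernstein0.
by rewrite bernsteinS IHm; ring.
Qed.

Definition alpha_mean alpha m x g : R :=
  \sum_(k < m.+1) p_alpha alpha m k x * g k.

Lemma alpha_mean1 alpha x g :
  alpha_mean alpha 1 x g = (1 - x) * g 0 + x * g 1.
Proof. by rewrite /alpha_mean !big_ord_recr/= big_ord0 add0r. Qed.

(** The weights are a mixture of a binomial law with m + 2 trials and of the
    law of S + 2 X, where S has m trials and X is an independent Bernoulli
    variable, all with success probability x. *)
Lemma alpha_meanE alpha m x g : alpha_mean alpha m.+2 x g =
  (1 - alpha) * ((1 - x) * bernstein m x g
                 + x * bernstein m x (fun k => g k.+2))
  + alpha * bernstein m.+2 x g.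
Proof.
rewrite /alpha_mean /p_alpha/= subSS subSS subn0.
under eq_bigr do rewrite mulrDl mulrDl.
rewrite !big_split/= mulrDr; congr (_ + _ + _).
- rewrite !big_ord_recr/= (@bin_small m m.+1)// (@bin_small m m.+2)//.
  rewrite !mul0r !addr0 /bernstein !mulr_sumr.
  rewrite [in RHS]big_ord_recr/=; congr (_ + _); last first.
    by rewrite subnn -addn2 addKn /= expr1 expr0; ring.
  apply: eq_bigr => k _; have km := ltn_ord k.
  rewrite (_ : (m.+2 - k - 1 = (m - k).+1)%N); last by lia.
  by rewrite exprS; ring.
- rewrite 2!big_ord_recl/= !mul0r !add0r /bernstein !mulr_sumr.
  apply: eq_bigr => k _; rewrite /bump/= !add1n !subSS !subn0.
  by rewrite exprS; ring.
- by rewrite /bernstein mulr_sumr; apply: eq_bigr => k _; ring.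
Qed.

Lemma p_alpha_gt alpha m x : (0 < m)%N -> p_alpha alpha m m.+1 x = 0.
Proof.
case: m => // -[|m] // _; rewrite /p_alpha/=.
by rewrite !bin_small ?mul0r ?addr0//; lia.
Qed.

Lemma p_alpha_ge0 alpha m k x : 0 <= alpha <= 1 -> 0 <= x <= 1 ->
  0 <= p_alpha alpha m k x.
Proof.
move=> /andP[al0 al1] /andP[x0 x1]; rewrite /p_alpha; case: ifPn => _.
  by case: k => [|[|k]]//; rewrite subr_ge0.
have y0 : 0 <= 1 - x by rewrite subr_ge0.
have b0 : 0 <= 1 - alpha by rewrite subr_ge0.
by rewrite !addr_ge0 ?mulr_ge0 ?exprn_ge0//; case: ifP.
Qed.

Lemma alpha_mean_cst alpha m x c : (0 < m)%N -> alpha_mean alpha m x (fun=> c) = c.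
Proof.
case: m => // -[|m] _; first by rewrite alpha_mean1; ring.
by rewrite alpha_meanE !bernstein_cst; ring.
Qed.

Lemma alpha_meanD alpha m x g1 g2 :
  alpha_mean alpha m x (fun k => g1 k + g2 k)
  = alpha_mean alpha m x g1 + alpha_mean alpha m x g2.
Proof.
by rewrite /alpha_mean -big_split/=; apply: eq_bigr => k _; rewrite mulrDr.
Qed.

Lemma alpha_meanZ alpha m x c g :
  alpha_mean alpha m x (fun k => c * g k) = c * alpha_mean alpha m x g.
Proof.
by rewrite /alpha_mean mulr_sumr; apply: eq_bigr => k _; rewrite mulrCA.
Qed.

Lemma ler_norm_alpha_mean alpha m x g1 g2 : 0 <= alpha <= 1 -> 0 <= x <= 1 ->
  (forall k, (k <= m)%N -> `|g1 k| <= g2 k) ->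
  `|alpha_mean alpha m x g1| <= alpha_mean alpha m x g2.
Proof.
move=> al x01 g12; apply: (le_trans (ler_norm_sum _ _ _)).
apply: ler_sum => k _; rewrite normrM ger0_norm; last exact: p_alpha_ge0.
by apply: ler_wpM2l; [exact: p_alpha_ge0 | apply: g12; rewrite -ltnS].
Qed.

(** The restriction to m >= 2 matters: for m = 1 the variance is x (1 - x),
    whatever alpha is. *)
Lemma alpha_mean_sqr alpha m x c :
  alpha_mean alpha m.+2 x (fun k => (k%:R - c) ^+ 2) =
  (m.+2%:R + 2 * (1 - alpha)) * (x * (1 - x)) + (m.+2%:R * x - c) ^+ 2.
Proof.
rewrite alpha_meanE.
have -> : (fun k : nat => (k.+2%:R - c) ^+ 2) = (fun k => (k%:R - (c - 2)) ^+ 2).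
  by apply/funext => k; rewrite -addn2 natrD; congr (_ ^+ 2); ring.
rewrite !bernstein_sqr (_ : m.+2%:R = m%:R + 2 :> R); last by rewrite -addn2 natrD.
ring.
Qed.

(** The offset u covers both averages of the operator: u = 0 for the weights
    p_(m,k) and u = 1 for the shifted weights p_(m,k-1), the nodes being k / n
    with n = m + 1 in both cases. *)
Lemma alpha_mean_sqr_le alpha m x u :
  0 <= alpha <= 1 -> 0 <= x <= 1 -> 0 <= u <= 1 -> (0 < m)%N ->
  alpha_mean alpha m x (fun k => (k%:R - (m.+1%:R * x - u)) ^+ 2) <= m.+1%:R.
Proof.
move=> /andP[al0 al1] /andP[x0 x1] /andP[u0 u1].
have q0 : 0 <= x * (1 - x) by rewrite mulr_ge0 ?subr_ge0.
have q1 : x * (1 - x) <= 1 / 4.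
  rewrite -subr_ge0 (_ : _ - _ = (x - 1 / 2) ^+ 2) ?sqr_ge0//.
  by field.
have xu : (u - x) ^+ 2 <= 1.
  by rewrite -real_normK ?num_real// expr_le1// ler_norml; apply/andP; split; lra.
case: m => // -[|m] _.
  rewrite alpha_mean1 [leLHS](_ : _ = x * (1 - x) + (u - x) ^+ 2); last by ring.
  by rewrite -[2%:R]natr1; lra.
rewrite alpha_mean_sqr -[m.+3%:R]natr1.
rewrite (_ : _ - (_ - u) = u - x); last by ring.
have : 2 <= m.+2%:R :> R by rewrite ler_nat.
move: (m.+2%:R : R) => M M2.
have : (M + 2 * (1 - alpha)) * (x * (1 - x)) <= (M + 2) * (1 / 4).
  by apply: ler_pM => //; lra.
lra.
Qed.

End bernstein_moments.

(** * Beta integrals *)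

Section beta_integral.
Context {R : realType}.
Implicit Types (a b x t : R) (f g : R -> R).

Local Notation mu := (@lebesgue_measure R).
Local Notation cmu := (@completed_lebesgue_measure R).
Local Notation I01 := (`[0, 1]%classic : set R).

(** Image measure under the identity: it is measurable from the Lebesgue sets to
    the Borel sets, and the completed measure extends the Borel one. This gives
    access to the fundamental theorem of calculus for the completed measure. *)
Lemma Rintegral_completed f : measurable_fun setT f ->
  \int[cmu]_(t in I01) f t = \int[mu]_(t in I01) f t.
Proof.
move=> mf.
pose phi : caratheodory_type (@wlength R idfun)^*%mu -> measurableTypeR R := idfun.
have mphi : measurable_fun setT phi.
  by move=> _ A mA; rewrite setTI; exact: sub_caratheodory.
have pf (h : measurableTypeR R -> \bar R) :
    measurable_fun setT h -> (forall t, 0 <= h t)%E ->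
    (\int[cmu]_(t in I01) h t = \int[mu]_(t in I01) h t)%E.
  move=> mh h0.
  have mI : measurable (I01 : set (measurableTypeR R)) by exact: measurable_itv.
  have := @ge0_integral_pushforward _ _ _ _ _ _ mphi cmu _ h mI.
  by rewrite /phi/= => <- //; exact: measurable_funTS.
rewrite /Rintegral integralE [in RHS]integralE; congr (fine (_ - _)%E).
- by apply: pf => //; apply: measurable_funepos; exact/measurable_EFinP.
- by apply: pf => //; apply: measurable_funeneg; exact/measurable_EFinP.
Qed.

Lemma lebesgue_measurable_borel f : measurable_fun setT f ->
  lebesgue_measurable_fun I01 f.
Proof.
move=> mf mD A mA; apply: measurableI => //.
apply: sub_caratheodory; rewrite -[X in _ X]setTI; exact: mf.
Qed.

Definition beta_kernel a b t : R := t `^ a * (1 - t) `^ b.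

Lemma measurable_beta_kernel a b : measurable_fun setT (beta_kernel a b).
Proof.
apply: measurable_funM => //.
apply: (measurableT_comp (measurable_powR _)) => //.
exact: measurable_funB.
Qed.

Lemma powR01_le1 a t : 0 <= a -> 0 <= t <= 1 -> t `^ a <= 1.
Proof.
move=> a0 /andP[t0 t1]; apply: (@le_trans _ _ (1 `^ a)); last by rewrite powR1.
by apply: (ge0_ler_powR a0); rewrite ?nnegrE.
Qed.

Lemma beta_kernel_ge0 a b t : 0 <= beta_kernel a b t.
Proof. by rewrite mulr_ge0 ?powR_ge0. Qed.

Lemma beta_kernel_le1 a b t : 0 <= a -> 0 <= b -> 0 <= t <= 1 ->
  beta_kernel a b t <= 1.
Proof.
move=> a0 b0 /andP[t0 t1]; rewrite mulr_ile1 ?powR_ge0 ?powR01_le1 ?t0//.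
by rewrite subr_ge0 t1/= lerBlDr lerDl.
Qed.

Lemma powR_continuous_at a x : 0 < x -> {for x, continuous (fun t => t `^ a)}.
Proof.
move=> x0; apply: differentiable_continuous; apply/derivable1_diffP.
exact: (@ex_derive _ _ _ _ _ _ _ (is_derive1_powR a x0)).
Qed.

(** Only a one-sided limit holds: a real power of a negative number is 1 by
    convention. *)
Lemma powR_cvg_at_right0 a : 0 <= a -> t `^ a @[t --> 0^'+] --> 0 `^ a.
Proof.
rewrite le_eqVlt => /predU1P[<-|a0].
  by rewrite powRr0; under eq_fun do rewrite powRr0; exact: cvg_cst.
by rewrite powR0 ?gt_eqF//; exact: powR_cvg0.
Qed.

Lemma beta_kernel_derivable a b t : 0 < t < 1 ->
  is_derive t 1 (beta_kernel a b)
    (a * beta_kernel (a - 1) b t - b * beta_kernel a (b - 1) t).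
Proof.
move=> /andP[t0 t1].
have y0 : 0 < 1 - t by rewrite subr_gt0.
have dy : is_derive t 1 (fun t => 1 - t) (-1 : R).
  have := is_deriveB (is_derive_cst (1 : R) t 1) (is_derive_id t (1 : R)).
  by rewrite sub0r.
have dp : is_derive (1 - t) 1 (fun t : R => t `^ b) (b * (1 - t) `^ (b - 1)).
  exact: is_derive1_powR.
have d1 := @is_derive1_comp R _ (fun t => 1 - t) t _ _ dp dy.
have d2 := is_deriveM (is_derive1_powR a t0) d1.
apply: (is_derive_eq d2).
rewrite /beta_kernel /= /GRing.scale/=; ring.
Qed.

Lemma beta_kernel_derivable_oo a b : 0 <= a -> 0 <= b ->
  derivable_oo_LRcontinuous (beta_kernel a b) 0 1.
Proof.
move=> a0 b0; split.
- move=> t; rewrite in_itv/= => t01.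
  exact: (@ex_derive _ _ _ _ _ _ _ (beta_kernel_derivable a b t01)).
- apply: cvgM; first exact: powR_cvg_at_right0.
  apply: cvg_at_right_filter.
  apply: (@continuous_comp _ _ _ (fun t : R => 1 - t) (fun t => t `^ b)).
    by apply: continuousB => //; exact: cst_continuous.
  by apply: powR_continuous_at; rewrite subr0.
- apply: cvgM.
    apply: cvg_at_left_filter.
    exact: powR_continuous_at.
  apply: (@decreasing_cvg_at_left_comp _ (fun t => 1 - t) (fun t => t `^ b) -oo%O).
  - by [].
  - by move=> u v _ _ uv; rewrite ltrD2l ltrN2.
  - apply: cvg_at_left_filter.
    by apply: continuousB => //; exact: cst_continuous.
  - by rewrite subrr; exact: powR_cvg_at_right0.
Qed.

Lemma beta_kernel_continuous a b : 0 <= a -> 0 <= b ->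
  {within `[0, 1], continuous (beta_kernel a b)}.
Proof.
by move=> a0 b0; apply: derivable_oo_LRcontinuous_within;
  exact: beta_kernel_derivable_oo.
Qed.

Definition beta_int a b : R := \int[cmu]_(t in I01) beta_kernel a b t.

Lemma measurable01 :
  measurable (I01 : set (caratheodory_type (@wlength R idfun)^*%mu)).
Proof. by apply: sub_caratheodory; exact: measurable_itv. Qed.

Lemma lebesgue_measure01 : mu I01 = 1%E.
Proof. by rewrite lebesgue_measure_itv/= lte_fin ltr01 oppr0 adde0. Qed.

Lemma bounded_integrable01 f : lebesgue_measurable_fun I01 f ->
  (exists M : R, forall t, 0 <= t <= 1 -> `|f t| <= M) ->
  cmu.-integrable I01 (EFin \o f).
Proof.
move=> mf [M fM]; apply: measurable_bounded_integrable => //.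
- exact: measurable01.
- by rewrite [ltLHS](_ : _ = mu I01)// lebesgue_measure01; exact: ltry.
- exists M; split; first by rewrite num_real.
  move=> N MN t /=; rewrite in_itv/= => t01.
  exact: (le_trans (fM _ t01) (ltW MN)).
Qed.

Lemma beta_kernel_norm_le1 a b t : 0 <= a -> 0 <= b -> 0 <= t <= 1 ->
  `|beta_kernel a b t| <= 1.
Proof.
by move=> a0 b0 t01; rewrite ger0_norm ?beta_kernel_ge0 ?beta_kernel_le1.
Qed.

Lemma integrable_beta_kernel a b : 0 <= a -> 0 <= b ->
  cmu.-integrable I01 (EFin \o beta_kernel a b).
Proof.
move=> a0 b0; apply: bounded_integrable01.
  apply: lebesgue_measurable_borel; exact: measurable_beta_kernel.
by exists 1 => t; exact: beta_kernel_norm_le1.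
Qed.

(** Integrate t + (1 - t) = 1 against the kernel. *)
Lemma beta_intD a b : 0 <= a -> 0 <= b ->
  beta_int (a + 1) b + beta_int a (b + 1) = beta_int a b.
Proof.
move=> a0 b0; have a1 := addr_ge0 a0 ler01; have b1 := addr_ge0 b0 ler01.
rewrite /beta_int -RintegralD; [|exact: measurable01|exact: integrable_beta_kernel..].
apply: eq_Rintegral => t; rewrite inE/= in_itv/= => /andP[t0 t1].
rewrite /beta_kernel -(mulr_powRB1 t0 (ltr_wpDl a0 ltr01)) addrK.
have y0 : 0 <= 1 - t by rewrite subr_ge0.
rewrite -(mulr_powRB1 y0 (ltr_wpDl b0 ltr01)) addrK; ring.
Qed.

(** Integrate the derivative of t^(a+1) (1-t)^(b+1), which vanishes at both
    endpoints. *)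
Lemma beta_int_by_parts a b : 0 <= a -> 0 <= b ->
  (a + 1) * beta_int a (b + 1) = (b + 1) * beta_int (a + 1) b.
Proof.
move=> a0 b0; have a1 := addr_ge0 a0 ler01; have b1 := addr_ge0 b0 ler01.
have i1 := integrable_beta_kernel a0 b1.
have i2 := integrable_beta_kernel a1 b0.
have m01 := measurable01.
apply/eqP; rewrite -subr_eq0; apply/eqP.
rewrite /beta_int -!RintegralZl// -RintegralB//; last 2 first.
- by have := integrableZl m01 (a + 1) i1.
- by have := integrableZl m01 (b + 1) i2.
rewrite Rintegral_completed; last first.
  by apply: measurable_funB; apply: measurable_funM => //; exact: measurable_beta_kernel.
rewrite /Rintegral (@continuous_FTC2 _ _ (beta_kernel (a + 1) (b + 1)))//.
- by rewrite /beta_kernel subrr !powR0 ?gt_eqF ?ltr_wpDl// mul0r mulr0 subee.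
- by move=> t; apply: cvgB; (apply: cvgM; [exact: cvg_cst|exact: beta_kernel_continuous]).
- exact: beta_kernel_derivable_oo.
- move=> t; rewrite in_itv/= => t01.
  have d := beta_kernel_derivable (a + 1) (b + 1) t01.
  by rewrite derive1E derive_val !addrK.
Qed.

Lemma beta_intSl a b : 0 <= a -> 0 <= b ->
  beta_int (a + 1) b = (a + 1) / (a + b + 2) * beta_int a b.
Proof.
move=> a0 b0; rewrite -(beta_intD a0 b0).
have s0 : a + b + 2 != 0 by lra.
apply: (mulfI s0); rewrite mulrA mulrCA mulfV// mulr1 mulrDr.
by rewrite beta_int_by_parts//; ring.
Qed.

Lemma beta_intSr a b : 0 <= a -> 0 <= b ->
  beta_int a (b + 1) = (b + 1) / (a + b + 2) * beta_int a b.
Proof.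
move=> a0 b0; have s0 : a + b + 2 != 0 by lra.
have /(congr1 (fun z => z - beta_int (a + 1) b)) := beta_intD a0 b0.
rewrite addrAC subrr add0r => ->; rewrite beta_intSl//; field.
exact: s0.
Qed.

Lemma beta_int00 : beta_int 0 0 = 1.
Proof.
rewrite /beta_int; under eq_Rintegral do rewrite /beta_kernel !powRr0 mulr1.
rewrite Rintegral_completed; last exact: measurable_cst.
rewrite Rintegral_cst; last exact: measurable_itv.
by rewrite mul1r -[RHS]/(fine 1) -lebesgue_measure01.
Qed.

Lemma beta_int_nat_gt0 m n : 0 < beta_int m%:R n%:R.
Proof.
elim: m => [|m IHm].
  elim: n => [|n IHn]; first by rewrite beta_int00.
  by rewrite -natr1 beta_intSr// mulr_gt0// divr_gt0 ?ltr_wpDl ?addr_ge0//.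
by rewrite -natr1 beta_intSl// mulr_gt0// divr_gt0 ?ltr_wpDl ?addr_ge0//.
Qed.

(** The successor keeps the exponent positive, so that the left side vanishes at
    t = 0, where t `^ 0 = 1. *)
Lemma powR01_nat_le a t : 0 <= a -> 0 <= t <= 1 ->
  t `^ (Num.truncn a).+1%:R <= t `^ a.
Proof.
move=> a0 /andP[]; rewrite le_eqVlt => /predU1P[<- _|t0 t1].
  by rewrite powR0 ?pnatr_eq0// powR_ge0.
by apply: ger_powR; rewrite ?t0// ltW// truncnS_gt.
Qed.

(** Larger exponents make the kernel smaller on [0, 1], so the integral is
    bounded below by one with natural exponents, which the recurrences compute
    from the integral of 1. *)
Lemma beta_int_gt0 a b : 0 <= a -> 0 <= b -> 0 < beta_int a b.
Proof.
move=> a0 b0.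
apply: (lt_le_trans (beta_int_nat_gt0 (Num.truncn a).+1 (Num.truncn b).+1)).
apply: le_Rintegral.
- exact: measurable01.
- exact: integrable_beta_kernel.
- exact: integrable_beta_kernel.
- move=> t; rewrite /= in_itv/= => /andP[t0 t1].
  apply: ler_pM; rewrite ?powR_ge0 ?powR01_nat_le ?t0//.
  by rewrite subr_ge0 t1/= lerBlDr lerDl.
Qed.

Lemma beta_kernelX a b t : 0 <= a -> 0 <= t ->
  beta_kernel (a + 1) b t = t * beta_kernel a b t.
Proof.
move=> a0 t0; rewrite /beta_kernel -(mulr_powRB1 t0 (ltr_wpDl a0 ltr01)) addrK.
by rewrite mulrA.
Qed.

(** Variance plus squared bias of the Beta law with parameters a + 1, b + 1. *)
Lemma beta_second_moment a b x : 0 <= a -> 0 <= b ->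
  \int[cmu]_(t in I01) (beta_kernel a b t * (t - x) ^+ 2) =
  beta_int a b * ((a + 1) * (b + 1) / ((a + b + 2) ^+ 2 * (a + b + 3))
                  + ((a + 1) / (a + b + 2) - x) ^+ 2).
Proof.
move=> a0 b0; have a1 := addr_ge0 a0 ler01; have a2 := addr_ge0 a1 ler01.
have i0 := integrable_beta_kernel a0 b0.
have i1 := integrable_beta_kernel a1 b0.
have i2 := integrable_beta_kernel a2 b0.
have m01 := measurable01.
have j0 := integrableZl m01 (x ^+ 2) i0.
have j1 := integrableZl m01 (- 2 * x) i1.
transitivity (\int[cmu]_(t in I01) (beta_kernel (a + 1 + 1) b t
    + ((- 2 * x) * beta_kernel (a + 1) b t + x ^+ 2 * beta_kernel a b t))).
  apply: eq_Rintegral => t; rewrite inE/= in_itv/= => /andP[t0 t1].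
  by rewrite !beta_kernelX//; ring.
rewrite RintegralD//; last by have := integrableD m01 j1 j0.
rewrite RintegralD// !RintegralZl// -!/(beta_int _ _) !beta_intSl//.
by field; apply/andP; split; lra.
Qed.

End beta_integral.

(** * Averaging a function against a Beta density *)

Section beta_average.
Context {R : realType}.
Implicit Types (a b c x y t W : R) (f g : R -> R).

Local Notation cmu := (@completed_lebesgue_measure R).
Local Notation I01 := (`[0, 1]%classic : set R).

Lemma integrable_beta_kernelM a b g : 0 <= a -> 0 <= b ->
  lebesgue_measurable_fun I01 g ->
  (exists M : R, forall t, 0 <= t <= 1 -> `|g t| <= M) ->
  cmu.-integrable I01 (EFin \o (fun t => beta_kernel a b t * g t)).
Proof.
move=> a0 b0 mg [M gM]; apply: bounded_integrable01.
  apply: measurable_funM => //.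
  by apply: lebesgue_measurable_borel; exact: measurable_beta_kernel.
exists M => t t01; rewrite normrM (le_trans _ (gM _ t01))// ler_piMl//.
exact: beta_kernel_norm_le1.
Qed.

(** A quadratic bound on |f t - y| integrates to the second moment. *)
Lemma beta_average_dist a b c W y x f : 0 <= a -> 0 <= b ->
  lebesgue_measurable_fun I01 f ->
  (exists M : R, forall t, 0 <= t <= 1 -> `|f t| <= M) ->
  (forall t, 0 <= t <= 1 -> `|f t - y| <= (1 + c * (t - x) ^+ 2) * W) ->
  `|\int[cmu]_(t in I01) (beta_kernel a b t / beta_int a b * f t) - y| <=
  (1 + c * ((a + 1) * (b + 1) / ((a + b + 2) ^+ 2 * (a + b + 3))
            + ((a + 1) / (a + b + 2) - x) ^+ 2)) * W.
Proof.
move=> a0 b0 mf bf fy; set V := (_ / _ + _).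
have B0 := beta_int_gt0 a0 b0.
have m01 := @measurable01 R.
have i0 := integrable_beta_kernel a0 b0.
have i1 := integrable_beta_kernelM a0 b0 mf bf.
have i2 : cmu.-integrable I01 (EFin \o (fun t => beta_kernel a b t * (t - x) ^+ 2)).
  apply: integrable_beta_kernelM => //.
    apply: lebesgue_measurable_borel.
    by apply: measurable_funX; exact: measurable_funB.
  exists ((1 + `|x|) ^+ 2) => t /andP[t0 t1]; rewrite normrX lerXn2r ?nnegrE ?addr_ge0//.
  by rewrite (le_trans (ler_normB _ _))// lerD2r ger0_norm.
have i3 := integrableZr m01 y i0.
have E : \int[cmu]_(t in I01) (beta_kernel a b t / beta_int a b * f t) - y =
    (beta_int a b)^-1 * \int[cmu]_(t in I01)
      (beta_kernel a b t * f t - beta_kernel a b t * y).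
  rewrite RintegralB// RintegralZr// mulrBr mulKf ?gt_eqF//; congr (_ - _).
  by rewrite -RintegralZl//; apply: eq_Rintegral => t _; ring.
rewrite E normrM gtr0_norm ?invr_gt0// mulrC ler_pdivrMr//.
have i4 := integrableB m01 i1 i3.
apply: (le_trans (le_normr_Rintegral m01 i4)).
have i5 := integrableZl m01 W i0.
have i6 := integrableZl m01 (c * W) i2.
apply: (@le_trans _ _ (\int[cmu]_(t in I01) (W * beta_kernel a b t
    + (c * W) * (beta_kernel a b t * (t - x) ^+ 2)))).
  apply: le_Rintegral => //.
  - exact: (integrable_norm i4).
  - exact: (integrableD m01 i5 i6).
  - move=> t; rewrite /= in_itv/= => t01.
    rewrite -mulrBr normrM ger0_norm ?beta_kernel_ge0//.
    rewrite [leRHS](_ : _ = beta_kernel a b t * ((1 + c * (t - x) ^+ 2) * W));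
      last by ring.
    by rewrite ler_wpM2l ?beta_kernel_ge0// fy.
rewrite RintegralD// !RintegralZl// beta_second_moment// -/V -/(beta_int a b).
by rewrite le_eqVlt; apply/orP; left; apply/eqP; ring.
Qed.

(** With s = a + b + 2 = N rho + 2 the variance (a+1)(b+1) / (s^2 (s+1)) is at
    most 1 / (4 (s+1)), and the bias of the mean is
    (rho (kappa - N x) + (1 - 2 x)) / s; the elementary bounds s^2 >= (N rho)^2
    and s^2 >= 8 N rho absorb the two parts of its square. *)
Lemma beta_spread_le (N rho kappa a b x : R) : 0 < N -> 0 < rho ->
  0 <= a -> 0 <= b -> a = kappa * rho -> a + b = N * rho -> 0 <= x <= 1 ->
  N * ((a + 1) * (b + 1) / ((a + b + 2) ^+ 2 * (a + b + 3))
       + ((a + 1) / (a + b + 2) - x) ^+ 2) <=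
  (2 * rho)^-1 + 2 / N * (kappa - N * x) ^+ 2.
Proof.
move=> N0 r0 a_ge0 b_ge0 ak ab /andP[x0 x1].
have Nr0 : 0 < N * rho by rewrite mulr_gt0.
set s := a + b + 2.
have sE : s = N * rho + 2 by rewrite /s ab.
have -> : a + b + 3 = s + 1 by rewrite /s; ring.
have s0 : 0 < s by rewrite sE; lra.
have s10 : 0 < s + 1 by lra.
have p1 : N * ((a + 1) * (b + 1) / (s ^+ 2 * (s + 1))) <= (4 * rho)^-1.
  rewrite mulrA ler_pdivrMr ?mulr_gt0 ?exprn_gt0//.
  rewrite [leRHS]mulrC ler_pdivlMr ?mulr_gt0//.
  have q : 4 * ((a + 1) * (b + 1)) <= s ^+ 2.
    by have := sqr_ge0 (a - b); rewrite /s; nra.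
  rewrite (_ : _ * (4 * rho) = (N * rho) * (4 * ((a + 1) * (b + 1)))); last by ring.
  rewrite [leRHS]mulrC; apply: ler_pM => //.
  - exact: ltW.
  - by rewrite !mulr_ge0 ?addr_ge0.
  - by rewrite sE; lra.
have p2 : N * ((a + 1) / s - x) ^+ 2 <= (4 * rho)^-1 + 2 / N * (kappa - N * x) ^+ 2.
  pose u := rho * (kappa - N * x); pose v := 1 - 2 * x.
  have -> : (a + 1) / s - x = (u + v) / s.
    rewrite -[in LHS](mulfK (lt0r_neq0 s0) x) -mulrBl; congr (_ / _).
    by rewrite sE ak /u /v; ring.
  have uv : (u + v) ^+ 2 <= 2 * u ^+ 2 + 2.
    have v1 : v ^+ 2 <= 1.
      rewrite /v; have := mulr_ge0 x0 (_ : 0 <= 1 - x); rewrite subr_ge0 => /(_ x1); nra.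
    rewrite -subr_ge0 (_ : _ - _ = (u - v) ^+ 2 + 2 * (1 - v ^+ 2)); last by ring.
    by rewrite addr_ge0 ?sqr_ge0// mulr_ge0// subr_ge0.
  rewrite expr_div_n mulrA ler_pdivrMr ?exprn_gt0//.
  apply: (@le_trans _ _ (N * (2 * u ^+ 2 + 2))); first by rewrite ler_wpM2l// ltW.
  have q1 : N * (2 * u ^+ 2) <= 2 / N * (kappa - N * x) ^+ 2 * s ^+ 2.
    rewrite (_ : N * _ = 2 / N * (kappa - N * x) ^+ 2 * (N * rho) ^+ 2); last first.
      by rewrite /u; field; rewrite gt_eqF.
    apply: ler_wpM2l; last by rewrite lerXn2r ?nnegrE ?ltW// sE ltrDl.
    by rewrite mulr_ge0 ?sqr_ge0// divr_ge0// ltW.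
  have q2 : N * 2 <= (4 * rho)^-1 * s ^+ 2.
    rewrite (_ : N * 2 = (4 * rho)^-1 * (8 * (N * rho))); last first.
      by field; rewrite gt_eqF.
    apply: ler_wpM2l; first by rewrite invr_ge0 mulr_ge0// ltW.
    by have := sqr_ge0 (N * rho - 2); rewrite sE; lra.
  rewrite [leLHS]mulrDr [leLHS]addrC [leRHS]mulrDl; exact: lerD.
rewrite mulrDr (_ : (2 * rho)^-1 = (4 * rho)^-1 + (4 * rho)^-1); last first.
  by field; rewrite gt_eqF.
lra.
Qed.

Lemma mu_rho_average_dist rho f (M W : R) n k x : 0 < rho -> (0 < n)%N -> (k <= n)%N ->
  lebesgue_measurable_fun I01 f ->
  (forall t, 0 <= t <= 1 -> `|f t| <= M) ->
  (forall t, 0 <= t <= 1 -> `|f t - f x| <= (1 + n%:R * (t - x) ^+ 2) * W) ->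
  0 <= x <= 1 -> 0 <= W ->
  `|\int[cmu]_(t in I01) (mu_rho rho n k t * f t) - f x| <=
  (1 + (2 * rho)^-1 + 2 / n%:R * (k%:R - n%:R * x) ^+ 2) * W.
Proof.
move=> r0 n0 kn mf fM fx x01 W0.
have a0 : 0 <= k%:R * rho by rewrite mulr_ge0// ltW.
have b0 : 0 <= (n - k)%:R * rho by rewrite mulr_ge0// ltW.
have bf : exists M : R, forall t, 0 <= t <= 1 -> `|f t| <= M by exists M.
have BE : Beta (k%:R * rho + 1) ((n - k)%:R * rho + 1)
    = beta_int (k%:R * rho) ((n - k)%:R * rho).
  by rewrite /Beta !addrK.
rewrite /mu_rho BE.
apply: (le_trans (beta_average_dist a0 b0 mf bf fx)).
apply: ler_wpM2r => //; rewrite -[leRHS]addrA lerD2l.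
apply: beta_spread_le => //; first by rewrite ltr0n.
by rewrite -mulrDl -natrD subnKC.
Qed.

End beta_average.

(** * The modulus of continuity *)

Section modulus.
Context {R : realType}.
Implicit Types (f : R -> R) (x y t d W : R).

(** Cut the segment from x to y, which stays inside [0, 1], into N + 1 equal
    pieces. *)
Lemma dist_le_steps f d W :
  (forall x y, 0 <= x <= 1 -> 0 <= y <= 1 -> `|x - y| <= d -> `|f x - f y| <= W) ->
  forall N x y, 0 <= x <= 1 -> 0 <= y <= 1 -> `|x - y| <= N.+1%:R * d ->
  `|f x - f y| <= N.+1%:R * W.
Proof.
move=> fW; elim=> [|N IHN] x y x01 y01; first by rewrite !mul1r; exact: fW.
move=> xy.
have [s [s0 s1 Ns]] : exists s : R, [/\ 0 < s, s <= 1 & N.+2%:R * s = 1].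
  by exists N.+2%:R^-1; rewrite invr_gt0 ltr0n invf_le1 ?ltr0n// ler1n divff.
pose z := x + (y - x) * s.
have xys : `|(x - y) * s| <= d.
  rewrite normrM (ger0_norm (ltW s0)) -[leRHS]mul1r -Ns mulrAC.
  by rewrite ler_wpM2r// ltW.
have z01 : 0 <= z <= 1.
  by move: x01 y01 => /andP[? ?] /andP[? ?]; apply/andP; rewrite /z; split; nra.
have xz : `|x - z| <= d by rewrite (_ : x - z = (x - y) * s)// /z; ring.
have zy : `|z - y| <= N.+1%:R * d.
  have N1s : N.+1%:R * s = 1 - s by move: Ns; rewrite -[N.+2%:R]natr1 mulrDl mul1r; lra.
  have -> : z - y = N.+1%:R * ((x - y) * s) by rewrite mulrCA N1s /z; ring.
  by rewrite normrM normr_nat ler_wpM2l.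
rewrite -[N.+2%:R]natr1 mulrDl mul1r [leRHS]addrC.
rewrite (_ : f x - f y = (f x - f z) + (f z - f y)); last by ring.
by rewrite (le_trans (ler_normD _ _))// lerD ?fW ?IHN.
Qed.

(** With r = |x - y| / d, the number of steps needed is at most
    1 + floor r <= 1 + r^2, because an integer is at most its square. *)
Lemma dist_le_sqr f d W : 0 < d ->
  (forall x y, 0 <= x <= 1 -> 0 <= y <= 1 -> `|x - y| <= d -> `|f x - f y| <= W) ->
  forall x y, 0 <= x <= 1 -> 0 <= y <= 1 ->
  `|f x - f y| <= (1 + d ^- 2 * (x - y) ^+ 2) * W.
Proof.
move=> d0 fW x y x01 y01.
have W0 : 0 <= W.
  by apply: (le_trans _ (fW x x x01 x01 _)); rewrite ?subrr ?normr0// ltW.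
pose r := `|x - y| / d; have r0 : 0 <= r by rewrite divr_ge0// ltW.
have /andP[Nr rN] := truncn_itv r0.
apply: (le_trans (dist_le_steps fW (N := Num.truncn r) x01 y01 _)).
  by rewrite -ler_pdivrMr// ltW.
apply: ler_wpM2r => //.
rewrite (_ : d ^- 2 * _ = r ^+ 2); last first.
  by rewrite /r expr_div_n real_normK ?num_real// mulrC.
rewrite -natr1 addrC lerD2l.
apply: (@le_trans _ _ ((Num.truncn r)%:R ^+ 2)); last by rewrite lerXn2r ?nnegrE.
by rewrite -natrX ler_nat; case: (Num.truncn r) => // N; rewrite leq_pmulr.
Qed.

Lemma modulus01_fin f (M d : R) : 0 <= d ->
  (forall t, 0 <= t <= 1 -> `|f t| <= M) ->
  exists2 W : R, 0 <= W /\ modulus01 f d = W%:E &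
    forall x y, 0 <= x <= 1 -> 0 <= y <= 1 -> `|x - y| <= d -> `|f x - f y| <= W.
Proof.
move=> d0 fM.
have m0 : (0 <= modulus01 f d)%E.
  apply: ereal_sup_ubound; exists (0, 0); last by rewrite /= subrr normr0.
  by rewrite /= subrr normr0 lexx ler01.
have mM : (modulus01 f d <= (M + M)%:E)%E.
  apply: ge_ereal_sup => _ [[x y] /= [x01 y01 _] <-]; rewrite lee_fin.
  by rewrite (le_trans (ler_normB _ _))// lerD// fM.
have mfin : modulus01 f d \is a fin_num.
  by rewrite ge0_fin_numE// (le_lt_trans mM)// ltry.
exists (fine (modulus01 f d)); first by rewrite fine_ge0// fineK.
move=> x y x01 y01 xy; rewrite -lee_fin fineK//.
by apply: ereal_sup_ubound; exists (x, y).
Qed.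

End modulus.

(** * The operator *)

Section operator.
Context {R : realType}.
Implicit Types (f : R -> R) (x y alpha rho W : R).

Local Notation cmu := (@completed_lebesgue_measure R).
Local Notation I01 := (`[0, 1]%classic : set R).

(** The last term of the first sum and the first term of the second one vanish,
    so both sums run over the nodes 0, ..., m. *)
Lemma J_alpha_mean alpha rho (a0 a1 : nat -> R) m f x : (0 < m)%N ->
  let h k := \int[cmu]_(t in I01) (mu_rho rho m.+1 k t * f t) in
  J alpha rho a0 a1 m.+1 f x =
  a_lin a0 a1 x m.+1 * alpha_mean alpha m x h
  + a_lin a0 a1 (1 - x) m.+1 * alpha_mean alpha m x (fun k => h k.+1).
Proof.
move=> m0 h; rewrite /J big_mkord -/(h _).
under eq_bigr => k _ do rewrite -/(h k) mulrDl.
rewrite big_split/=; congr (_ + _).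
  rewrite big_ord_recr/= p_alpha_gt// mulr0 mul0r addr0 /alpha_mean mulr_sumr.
  by apply: eq_bigr => k _; rewrite mulrA.
rewrite big_ord_recl/= mulr0 mul0r add0r /alpha_mean mulr_sumr.
by apply: eq_bigr => k _; rewrite mulrA.
Qed.

(** In the application g k is a squared distance from the node k, which can
    exceed c for a single k; its mean over k does not. *)
Lemma alpha_mean_dist alpha m x y W c d (h g : nat -> R) :
  0 <= alpha <= 1 -> 0 <= x <= 1 -> (0 < m)%N ->
  alpha_mean alpha m x g <= c -> 0 <= d -> 0 <= W ->
  (forall k, (k <= m)%N -> `|h k - y| <= (d + 2 / c * g k) * W) ->
  0 < c ->
  `|alpha_mean alpha m x h - y| <= (d + 2) * W.
Proof.
move=> al x01 m0 gc d0 W0 hy c0.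
rewrite -{1}(alpha_mean_cst alpha x y m0) -[X in _ - X]mul1r -mulNr.
rewrite -alpha_meanZ -alpha_meanD.
apply: (@le_trans _ _ (alpha_mean alpha m x (fun k => d * W + (2 / c * W) * g k))).
  apply: ler_norm_alpha_mean => // k km; rewrite mulN1r (le_trans (hy k km))//.
  by rewrite le_eqVlt; apply/orP; left; apply/eqP; ring.
rewrite alpha_meanD alpha_mean_cst// alpha_meanZ [leRHS]mulrDl lerD2l.
rewrite (_ : 2 * W = 2 / c * W * c); last by field; rewrite gt_eqF.
by rewrite ler_wpM2l// mulr_ge0// divr_ge0// ltW.
Qed.

(** Under the normalization the coefficient is x + a0 (1 - 2 x). *)
Lemma a_lin_norm_le (a0 a1 : nat -> R) n x :
  2 * a0 n + a1 n = 1 -> 0 <= x <= 1 -> `|a_lin a0 a1 x n| <= 1 + `|a0 n|.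
Proof.
move=> a01 /andP[x0 x1].
rewrite (_ : a_lin _ _ _ _ = x + a0 n * (1 - 2 * x)); last first.
  by rewrite /a_lin (_ : a1 n = 1 - 2 * a0 n); [ring|lra].
rewrite (le_trans (ler_normD _ _))// lerD//; first by rewrite ger0_norm.
by rewrite normrM ler_piMr// ler_norml; lra.
Qed.

Lemma affine_comb_dist (A B e1 e2 y q w : R) : A + B = 1 ->
  `|A| <= q -> `|B| <= q -> `|e1 - y| <= w -> `|e2 - y| <= w ->
  `|A * e1 + B * e2 - y| <= 2 * q * w.
Proof.
move=> AB Aq Bq ew1 ew2.
rewrite (_ : _ - y = A * (e1 - y) + B * (e2 - y)); last first.
  by rewrite (_ : B = 1 - A); [ring|lra].
rewrite (le_trans (ler_normD _ _))// !normrM.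
rewrite (_ : 2 * q * w = q * w + q * w); last by ring.
by apply: lerD; apply: ler_pM.
Qed.

End operator.

Theorem theorem5 (R : realType) (alpha rho : R) (a0 a1 : nat -> R)
    (halpha : 0 <= alpha <= 1) (hrho : 0 < rho)
    (ha0 : bounded_fun a0)
    (ha : forall n : nat, 2 * a0 n + a1 n = 1) :
  exists C3 : R, 0 < C3 /\
    forall (f : R -> R) (n : nat),
      [bounded f x | x in `[0, 1]%classic] ->
      lebesgue_measurable_fun `[0, 1] f ->
      (2 <= n)%N ->
      (unif_norm01 (fun x => (J alpha rho a0 a1 n f x - f x)%R)
       <= ((1 + 3 * `|a0 n|) * C3)%:E * modulus01 f (Num.sqrt n%:R)^-1)%E.
Proof.
exists (2 * (3 + (2 * rho)^-1)).
have r0 : 0 <= (2 * rho)^-1 by rewrite invr_ge0 mulr_ge0// ltW.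
split; first by lra.
move=> f [//|m] [M0 [_ fM0]] mf m0; rewrite ltnS in m0.
have n0 : 0 < m.+1%:R :> R by rewrite ltr0n.
pose M := M0 + 1.
have fM t : 0 <= t <= 1 -> `|f t| <= M.
  by move=> t01; apply: fM0; rewrite ?ltrDl//= in_itv.
pose d : R := (Num.sqrt m.+1%:R)^-1.
have d0 : 0 < d by rewrite invr_gt0 sqrtr_gt0.
have d2 : d ^- 2 = m.+1%:R by rewrite /d exprVn invrK sqr_sqrtr// ltW.
have [W [W0 ->] fW] := modulus01_fin (ltW d0) fM.
apply: ge_ereal_sup => _ [x x01 <-].
rewrite -EFinM lee_fin; move: x01; rewrite /= in_itv/= => x01.
have fx t : 0 <= t <= 1 -> `|f t - f x| <= (1 + m.+1%:R * (t - x) ^+ 2) * W.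
  by move=> t01; rewrite -d2; exact: dist_le_sqr.
have := J_alpha_mean alpha rho a0 a1 f x m0; set h := fun k => _; move=> /= ->.
have hx k : (k <= m.+1)%N -> `|h k - f x| <=
    (1 + (2 * rho)^-1 + 2 / m.+1%:R * (k%:R - m.+1%:R * x) ^+ 2) * W.
  by move=> km; apply: (mu_rho_average_dist hrho _ km mf fM).
have d1 : 0 <= 1 + (2 * rho)^-1 by rewrite addr_ge0.
have u0 : 0 <= (0 : R) <= 1 by rewrite lexx ler01.
have u1 : 0 <= (1 : R) <= 1 by rewrite ler01 lexx.
have e1 := alpha_mean_dist (h := h) (y := f x) halpha x01 m0
  (alpha_mean_sqr_le halpha x01 u0 m0) d1 W0 _ n0.
have {}e1 : `|alpha_mean alpha m x h - f x| <= (1 + (2 * rho)^-1 + 2) * W.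
  by apply: e1 => k km; rewrite subr0; exact: hx (leqW km).
have e2 := alpha_mean_dist (h := fun k => h k.+1) (y := f x) halpha x01 m0
  (alpha_mean_sqr_le halpha x01 u1 m0) d1 W0 _ n0.
have {}e2 : `|alpha_mean alpha m x (fun k => h k.+1) - f x|
    <= (1 + (2 * rho)^-1 + 2) * W.
  by apply: e2 => k km; rewrite opprB addrCA addrC addrAC natr1; exact: hx.
set A := a_lin _ _ x _; set A' := a_lin _ _ (1 - x) _.
have AA : A + A' = 1 by rewrite -(ha m.+1) /A /A' /a_lin; ring.
apply: (le_trans (affine_comb_dist AA (a_lin_norm_le (ha _) x01)
  (a_lin_norm_le (ha _) _) e1 e2)).
  by move: x01 => /andP[? ?]; rewrite subr_ge0 lerBlDr lerDl; apply/andP.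
rewrite mulrA; apply: ler_wpM2r => //.
rewrite [leRHS]mulrCA [1 + _ + 2]addrAC -[1 + 2]/(3%:R) -mulrA.
rewrite ler_wpM2l// ler_wpM2r ?addr_ge0//.
by rewrite lerD2l ler_peMl// ler1n.
Qed.
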